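(* Let $\phi,\varphi\colon G_1\to G_2$ be quiver homomorphisms such that $\phi\simeq^{lSh}\varphi$ (local strong $h$-homotopic). Then $$\phi_*=\varphi_*\colon H_*^{\Delta,h}(G_1)\to H_*^{\Delta,h}(G_2).$$
   Context: A quiver $G=(V_G,E_G,s_G,t_G)$ consists of a non-empty set $V_G$ of vertices, a set $E_G$ of edges and functions $s_G,t_G\colon E_G\to V_G$. A quiver map $m\colon G\to G'$ is a pair $m_V\colon V_G\to V_{G'}$, $m_E\colon E_G\to E_{G'}\sqcup V_{G'}$ such that each $e$ is sent either to an edge with source $m_V(s(e))$ and target $m_V(t(e))$, or to the vertex $m_V(s(e))=m_V(t(e))$. A homomorphism is a quiver map sending edges to edges. A subquiver $H$ of $G$ has $V_H\subseteq V_G$, $E_H\subseteq E_G$ and restricted source and target functions; it is full if $E_H=\{e\in E_G\mid s_G(e),t_G(e)\in V_H\}$. $R$ is a fixed commutative ring. $\Delta^n$ is the quiver with vertices $0,\dots,n$ and exactly one edge $a\to b$ for each $a<b$ (no other edges); for $0\le i\le n$, $\delta_i\colon\Delta^{n-1}\to\Delta^n$ is the unique homomorphism with $\delta_i(j)=j$ for $j<i$ and $j+1$ otherwise. $C_n^{\Delta,h}(G)$ is the free $R$-module on homomorphisms $f\colon\Delta^n\to G$, with differential $\partial_n(f)=\sum_{i=0}^n(-1)^if\circ\delta_i$; $H_*^{\Delta,h}(G)$ is its homology, and a homomorphism $\phi$ induces $\phi_*$ via $f\mapsto\phi\circ f$. For a full subquiver $G'$ of $G$, the strong mapping cylinder $M^S_{G'\hookrightarrow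 G}$ is the quiver with vertices $(V_G\times\{0\})\cup(V_{G'}\times\{1\})$ and the following edges: $(e,0)$ for $e\in E_G$, from $(s(e),0)$ to $(t(e),0)$; $(e,1)$ for $e\in E_{G'}$, from $(s(e),1)$ to $(t(e),1)$; $(v,0\to1)$ for $v\in V_{G'}$, from $(v,0)$ to $(v,1)$; $(e,0\to1)$ for $e\in E_{G'}$, from $(s(e),0)$ to $(t(e),1)$; and $e_{e_G}$ for each $e_G\in E_G$ having exactly one of $s(e_G),t(e_G)$ in $V_{G'}$, whose source is $(s(e_G),1)$ if $s(e_G)\in V_{G'}$ and $(s(e_G),0)$ otherwise, and whose target is $(t(e_G),1)$ if $t(e_G)\in V_{G'}$ and $(t(e_G),0)$ otherwise. Define inclusions $i_0,i_1\colon G\to M^S_{G'\hookrightarrow G}$: $i_0(v)=(v,0)$, $i_0(e)=(e,0)$; $i_1(v)=(v,1)$ if $v\in V_{G'}$ and $(v,0)$ otherwise; $i_1(e)=(e,1)$ if $e\in E_{G'}$, $i_1(e)=(e,0)$ if neither $s(e)$ nor $t(e)$ lies in $V_{G'}$, and $i_1(e)=e_e$ otherwise. Quiver maps $f_0,f_1\colon G_1\to G_2$ are $1$-step local strong $h$-homotopic, $f_0\simeq_1^{lSh}f_1$, if there are a full subquiver $G_1'$ of $G_1$ and a quiver homomorphism $F\colon M^S_{G_1'\hookrightarrow G_1}\to G_2$ with $F\circ i_0=f_0$ and $F\circ i_1=f_1$. The relation $\simeq^{lSh}$ (local strong $h$-homotopic) is the equivalence relation generated by $\simeq_1^{lSh}$.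 *)

(* Defs.v *)
From HB Require Import structures.
From mathcomp Require Import all_boot all_order all_algebra.
From mathcomp Require Import mathcomp_extra boolp classical_sets functions.
From mathcomp Require Import finmap cardinality fsbigop.
From Stdlib Require Import Relation_Operators.

Set Implicit Arguments.
Unset Strict Implicit.
Unset Printing Implicit Defensive.

Import GRing.Theory.
Local Open Scope classical_set_scope.
Local Open Scope quotient_scope.
Local Open Scope ring_scope.

Record quiver := Quiver {
  vert : Type;
  edge : Type;
  src : edge -> vert;
  tgt : edge -> vert;
  vert_inhabited : inhabited vert }.

Arguments src {q} _.
Arguments tgt {q} _.

Record quiver_map (G G' : quiver) := QuiverMap {
  mapV : vert G -> vert G';
  mapE : edge G -> edge G' + vert G';
  mapP : forall e,
    match mapE e with
    | inl e' => src e' = mapV (src e) /\ tgt e' = mapV (tgt e)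
    | inr v => v = mapV (src e) /\ v = mapV (tgt e)
    end }.

Lemma quiver_map_ext (G G' : quiver) (f g : quiver_map G G') :
  mapV f =1 mapV g -> mapE f =1 mapE g -> f = g.
Proof.
case: f g => [fV fE fP] [gV gE gP] /= /funext eV /funext eE.
subst gV gE; congr QuiverMap; exact: Prop_irrelevance.
Qed.

Section Composition.
Variables (G G' G'' : quiver) (g : quiver_map G' G'') (f : quiver_map G G').

Definition comp_mapE (e : edge G) : edge G'' + vert G'' :=
  match mapE f e with
  | inl e' => mapE g e'
  | inr v => inr (mapV g v)
  end.

Fact comp_mapP e :
  match comp_mapE e with
  | inl e'' => src e'' = mapV g (mapV f (src e)) /\
               tgt e'' = mapV g (mapV f (tgt e))
  | inr v => v = mapV g (mapV f (src e)) /\ v = mapV g (mapV f (tgt e))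
  end.
Proof.
rewrite /comp_mapE; have := mapP f e; case: (mapE f e) => [e'|v] [].
  by move=> <- <-; exact: mapP.
by move=> <- <-.
Qed.

Definition comp_map : quiver_map G G'' :=
  @QuiverMap G G'' (mapV g \o mapV f) comp_mapE comp_mapP.
End Composition.

Definition is_hom (G G' : quiver) (f : quiver_map G G') :=
  forall e, exists e', mapE f e = inl e'.

Record quiver_hom (G G' : quiver) := QuiverHom {
  hom_map :> quiver_map G G';
  hom_mapP : is_hom hom_map }.

Lemma quiver_hom_ext (G G' : quiver) (f g : quiver_hom G G') :
  f = g :> quiver_map G G' -> f = g.
Proof.
case: f g => [f fP] [g gP] /= efg; subst g.
congr QuiverHom; exact: Prop_irrelevance.
Qed.

HB.instance Definition _ (G G' : quiver) := gen_eqMixin (quiver_hom G G').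
HB.instance Definition _ (G G' : quiver) := gen_choiceMixin (quiver_hom G G').

Fact comp_is_hom (G G' G'' : quiver) (g : quiver_hom G' G'')
  (f : quiver_hom G G') : is_hom (comp_map g f).
Proof.
move=> e /=; rewrite /comp_mapE; have [e' ->] := hom_mapP f e.
exact: hom_mapP.
Qed.

Definition comp_hom (G G' G'' : quiver) (g : quiver_hom G' G'')
    (f : quiver_hom G G') : quiver_hom G G'' :=
  QuiverHom (comp_is_hom g f).

Lemma comp_homA (G G' G'' G''' : quiver) (h : quiver_hom G'' G''')
    (g : quiver_hom G' G'') (f : quiver_hom G G') :
  comp_hom h (comp_hom g f) = comp_hom (comp_hom h g) f.
Proof.
apply/quiver_hom_ext/quiver_map_ext => // e /=.
by rewrite /comp_mapE /= /comp_mapE; case: (mapE f e).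
Qed.

Section MkHom.
Variables (G G' : quiver) (fV : vert G -> vert G') (fE : edge G -> edge G').
Hypothesis fP : forall e, src (fE e) = fV (src e) /\ tgt (fE e) = fV (tgt e).

Definition mk_map : quiver_map G G' :=
  @QuiverMap G G' fV (fun e => inl (fE e)) fP.

Fact mk_is_hom : is_hom mk_map. Proof. by move=> e; exists (fE e). Qed.

Definition mk_hom : quiver_hom G G' := QuiverHom mk_is_hom.
End MkHom.

Definition Delta_edge (n : nat) :=
  {p : 'I_n.+1 * 'I_n.+1 | (p.1 < p.2)%N}.

Definition Delta (n : nat) : quiver :=
  @Quiver 'I_n.+1 (Delta_edge n) (fun e => (val e).1) (fun e => (val e).2)
    (inhabits ord0).

Section Face.
Variables (n : nat) (i : 'I_n.+2).

Fact face_edge_subproof (e : Delta_edge n) :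
  (lift i (val e).1 < lift i (val e).2)%N.
Proof. by rewrite /= ltnNge leq_bump2 -ltnNge; exact: (valP e). Qed.

Definition face_edge (e : Delta_edge n) : Delta_edge n.+1 :=
  exist _ (lift i (val e).1, lift i (val e).2) (face_edge_subproof e).

(* [lift i j] is [j] if [j < i] and [j.+1] otherwise. *)
Definition face : quiver_hom (Delta n) (Delta n.+1) :=
  @mk_hom (Delta n) (Delta n.+1) (lift i) face_edge
    (fun e => conj erefl erefl).
End Face.

Lemma hom_Delta_ext (G : quiver) (n : nat) (f g : quiver_hom G (Delta n)) :
  mapV f =1 mapV g -> f = g.
Proof.
move=> efg; apply/quiver_hom_ext/quiver_map_ext => // e.
have [a ea] := hom_mapP f e; have [b eb] := hom_mapP g e.
have := mapP f e; have := mapP g e.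
rewrite ea eb /= => -[b1 b2] [a1 a2]; congr inl; apply: val_inj => /=.
move: b1 b2 a1 a2; rewrite !efg => <- <-.
by case: (val a) => x y /= -> ->; case: (val b).
Qed.

(* The free R-module on X is realized as the finitely supported functions     *)
(* X -> R; unlike [{malg R[X]}], this also covers the zero ring.              *)
Section FreeModule.
Variables (R : pzRingType) (X : choiceType).

Definition fin_supp : {pred X -> R^o} :=
  fun c => `[< finite_set [set x | c x != 0] >].

Fact fin_supp_submod_closed : submod_closed fin_supp.
Proof.
split=> [|a c d /asboolP fc /asboolP fd]; apply/asboolP.
  rewrite (_ : mkset _ = set0) //; apply/seteqP; split=> // x /=.
  by rewrite eqxx.
have : finite_set ([set x | c x != 0] `|` [set x | d x != 0]).
  by rewrite finite_setU.
apply: sub_finite_set => x /=; rewrite [X in X != 0](_ : _ = a * c x + d x) //.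
have [->|] := eqVneq (c x) 0; last by left.
have [->|] := eqVneq (d x) 0; last by right.
by rewrite mulr0 addr0 eqxx.
Qed.

HB.instance Definition _ :=
  GRing.isSubmodClosed.Build R (X -> R^o) fin_supp fin_supp_submod_closed.

Record free_module := FreeModule {
  coef :> X -> R^o;
  _ : coef \in fin_supp }.

HB.instance Definition _ := [isSub for coef].
HB.instance Definition _ := [Choice of free_module by <:].
HB.instance Definition _ := [SubChoice_isSubLmodule of free_module by <:].

Lemma coef_finite (c : free_module) : finite_set [set x | c x != 0].
Proof. by apply/asboolP; exact: (valP c). Qed.

Fact basis_subproof (x : X) : (fun y => (y == x)%:R : R^o) \in fin_supp.
Proof.
apply/asboolP; apply: (sub_finite_set _ (finite_set1 x)) => y /=.
by have [->//|_] := eqVneq y x; rewrite eqxx.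
Qed.

Definition basis (x : X) : free_module := FreeModule (basis_subproof x).
End FreeModule.

Section LinearExtension.
Variables (R : pzRingType) (X : choiceType) (M : lmodType R) (F : X -> M).

Definition lin_ext (c : free_module R X) : M :=
  \sum_(x \in [set: X]) (c x : R) *: F x.

Lemma lin_extE (s : {fset X}) (c : free_module R X) :
  [set x | c x != 0] `<=` [set` s] ->
  lin_ext c = \sum_(x <- s) (c x : R) *: F x.
Proof.
move=> cs; apply: fsbigTE => x xs; case: (eqVneq (c x) 0) => [->|cx].
  exact: scale0r.
by have := cs _ cx; rewrite /= (negbTE xs).
Qed.

Fact lin_ext_is_linear : linear lin_ext.
Proof.
move=> a c d.
have fs : finite_set ([set x | c x != 0] `|` [set x | d x != 0]).
  by rewrite finite_setU; split; exact: coef_finite.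
pose s := fset_set ([set x | c x != 0] `|` [set x | d x != 0]).
have [cs ds] : [set x | c x != 0] `<=` [set` s] /\
               [set x | d x != 0] `<=` [set` s].
  by split=> x xc; rewrite /= in_fset_set //; apply/mem_set; [left|right].
rewrite (lin_extE cs) (lin_extE ds).
rewrite scaler_sumr -big_split (@lin_extE s) /=.
  by apply: eq_bigr => x _; rewrite scalerA -scalerDl.
move=> x acd; have [cx|cx] := eqVneq (c x) 0; last exact: cs.
have [dx|dx] := eqVneq (d x) 0; last exact: ds.
move: acd => /=; rewrite [X in X != 0](_ : _ = a * c x + d x) //.
by rewrite cx dx mulr0 addr0 eqxx.
Qed.

HB.instance Definition _ :=
  GRing.isLinear.Build R (free_module R X) M _ lin_ext lin_ext_is_linear.

Lemma lin_ext_basis (x : X) : lin_ext (basis R x) = F x.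
Proof.
rewrite (@lin_extE [fset x]%fset) ?big_seq_fset1 /= ?eqxx ?scale1r //.
by move=> y /=; rewrite inE; have [//|_] := eqVneq y x; rewrite eqxx.
Qed.
End LinearExtension.

Lemma free_module_ind (R : pzRingType) (X : choiceType) (M : lmodType R)
    (f g : {linear free_module R X -> M}) :
  (forall x, f (basis R x) = g (basis R x)) -> f =1 g.
Proof.
move=> fg c.
have cs : [set x | c x != 0] `<=` [set` fset_set [set x | c x != 0]].
  by move=> x cx; rewrite /= in_fset_set ?mem_set //; exact: coef_finite.
suff -> : c = lin_ext (@basis R X) c.
  rewrite (lin_extE _ cs) !linear_sum.
  by apply: eq_bigr => x _; rewrite !linearZ /= fg.
apply: val_inj; apply/funext => x /=.
rewrite (lin_extE _ cs) (_ : coef (\sum_(y <- _) _) x =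
  \sum_(y <- fset_set [set x | c x != 0]) c y * (x == y)%:R); last first.
  by elim/big_rec2: _ => //= y a b _ <-.
have [cx|cx] := eqVneq (c x) 0.
  rewrite cx big1_seq // => y _; case: eqVneq => [<-|_]; last by rewrite mulr0.
  by rewrite cx mul0r.
rewrite (big_fsetD1 x) /=; last exact: cs.
rewrite eqxx mulr1 big1_seq ?addr0 // => y /andP[_].
by rewrite in_fsetD1 eq_sym => /andP[/negbTE -> _]; rewrite mulr0.
Qed.

Section Homology.
Variables (R : comPzRingType).

Definition chain (n : nat) (G : quiver) :=
  free_module R (quiver_hom (Delta n) G).

HB.instance Definition _ n G := GRing.Lmodule.on (chain n G).

Definition boundary (n : nat) (G : quiver) : chain n.+1 G -> chain n G :=
  lin_ext (fun f : quiver_hom (Delta n.+1) G =>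
    \sum_(i < n.+2) (-1) ^+ i *: basis R (comp_hom f (face i)) : chain n G).

HB.instance Definition _ n G := GRing.Linear.on (@boundary n G).

Lemma boundaryE n G (f : quiver_hom (Delta n.+1) G) :
  boundary (basis R f) =
  \sum_(i < n.+2) (-1) ^+ i *: basis R (comp_hom f (face i)).
Proof. exact: lin_ext_basis. Qed.

Section HomologyOf.
Variables (n : nat) (G : quiver).

(* The differential out of degree 0 is the zero map. *)
Definition is_cycle : {pred chain n G} :=
  match n return chain n G -> bool with
  | 0%N => fun=> true
  | m.+1 => fun c => boundary c == 0
  end.

Fact is_cycle_submod_closed : submod_closed is_cycle.
Proof.
rewrite /is_cycle; case: n => [|m]; first by split.
split=> [|a c d /eqP c0 /eqP d0]; apply/eqP; first exact: linear0.
by rewrite linearP /= c0 d0 scaler0 addr0.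
Qed.

HB.instance Definition _ :=
  GRing.isSubmodClosed.Build R (chain n G) is_cycle is_cycle_submod_closed.

Record cycles := Cycle {
  cycle_chain :> chain n G;
  _ : cycle_chain \in is_cycle }.

HB.instance Definition _ := [isSub for cycle_chain].
HB.instance Definition _ := [Choice of cycles by <:].
HB.instance Definition _ := [SubChoice_isSubLmodule of cycles by <:].

Definition is_boundary : {pred cycles} :=
  fun z => `[< exists c : chain n.+1 G, cycle_chain z = boundary c >].

Fact is_boundary_submod_closed : submod_closed is_boundary.
Proof.
split=> [|a z w /asboolP[c zc] /asboolP[d wd]]; apply/asboolP.
  by exists 0; rewrite linear0.
by exists (a *: c + d); rewrite linearP /= -zc -wd.
Qed.

HB.instance Definition _ :=
  GRing.isSubmodClosed.Build R cycles is_boundary is_boundary_submod_closed.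

Definition homology := Quotient.quot is_boundary.

HB.instance Definition _ := GRing.Zmodule.on homology.
HB.instance Definition _ := EqQuotient.on homology.

Definition homology_class (z : cycles) : homology := \pi_homology z.

Lemma homology_classP (z w : cycles) :
  reflect (exists c, cycle_chain z - cycle_chain w = boundary c)
    (homology_class z == homology_class w).
Proof. by rewrite /homology_class -Quotient.idealrBE; exact: asboolP. Qed.

Fact homology_class_is_zmod_morphism : zmod_morphism homology_class.
Proof. exact: (raddfB \pi_homology). Qed.

HB.instance Definition _ :=
  GRing.isZmodMorphism.Build cycles homology homology_class
    homology_class_is_zmod_morphism.

Lemma homology_class_surj (x : homology) : homology_class (repr x) = x.
Proof. exact: reprK. Qed.

Definition homology_scale (a : R) (x : homology) : homology :=
  homology_class (a *: repr x).

Lemma homology_scaleE a z :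
  homology_scale a (homology_class z) = homology_class (a *: z).
Proof.
have /eqP/homology_classP[c zc] := homology_class_surj (homology_class z).
apply/eqP/homology_classP; exists (a *: c).
by rewrite [RHS]linearZ /= -zc scalerBr.
Qed.

Fact homology_scaleA a b x :
  homology_scale a (homology_scale b x) = homology_scale (a * b) x.
Proof. by rewrite homology_scaleE scalerA. Qed.

Fact homology_scale1 : left_id 1 homology_scale.
Proof. by move=> x; rewrite /homology_scale scale1r homology_class_surj. Qed.

Fact homology_scaleDr : right_distributive homology_scale +%R.
Proof.
move=> a x y; rewrite -(homology_class_surj x) -(homology_class_surj y).
by rewrite -raddfD !homology_scaleE scalerDr raddfD.
Qed.

Fact homology_scaleDl x : {morph homology_scale^~ x : a b / a + b}.
Proof. by move=> a b; rewrite /homology_scale scalerDl raddfD. Qed.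

HB.instance Definition _ :=
  GRing.Zmodule_isLmodule.Build R homology homology_scaleA homology_scale1
    homology_scaleDr homology_scaleDl.

Fact homology_class_is_scalable : scalable homology_class.
Proof. by move=> a z; rewrite -homology_scaleE. Qed.

HB.instance Definition _ :=
  GRing.isScalable.Build R cycles homology _ homology_class
    homology_class_is_scalable.
End HomologyOf.

Lemma boundary_boundary n G (c : chain n.+2 G) : boundary (boundary c) = 0.
Proof.
pose f := @boundary n G \o @boundary n.+1 G.
have f0 : f =1 \0; last exact: (f0 c).
apply: free_module_ind => h; rewrite /f /= boundaryE linear_sum.
under eq_bigr => i _ do rewrite linearZ /= boundaryE scaler_sumr.
rewrite pair_big /= (bigID (fun p : 'I_n.+3 * 'I_n.+2 => (p.2 < p.1)%N)) /=.
apply/eqP; rewrite addr_eq0 -sumrN; apply/eqP.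
rewrite (reindex_onto
  (fun p : 'I_n.+3 * 'I_n.+2 => (lift ord0 p.2, inord p.1 : 'I_n.+2))
  (fun p : 'I_n.+3 * 'I_n.+2 => (widen_ord (leqnSn _) p.2, inord p.1.-1)))
  => [|[i k] /= ki]; last first.
  have i0 : (0 < i)%N by exact: leq_ltn_trans ki.
  rewrite inord_val; congr pair; apply: val_inj.
  by rewrite /= /bump /= inordK; [exact: prednK|rewrite prednK // -ltnS].
apply: eq_big => [[i k]|[i k]] /=.
  rewrite -leqNgt /bump /= !add1n.
  have [ik|ki] := leqP i k.
    have ik2 : (i < n.+2)%N by exact: leq_ltn_trans ik (ltn_ord k).
    rewrite inordK // ltnS ik /= inord_val; apply/eqP; congr pair.
    by apply: val_inj; rewrite /= inordK.
  have [ik2|] := ltnP i n.+2; first by rewrite inordK // ltnS leqNgt ki.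
  move=> ni; apply/negbTE; rewrite negb_and; apply/orP; right.
  apply/eqP => -[/(congr1 val) /= e _]; have := ltn_ord (inord i : 'I_n.+2).
  by rewrite e ltnNge ni.
move=> /andP[ik] /eqP[/(congr1 val) /= e1 /(congr1 val) /= e2].
rewrite /bump /= add1n in ik *; rewrite e1 ltnS in ik *.
rewrite exprS mulN1r scaleNr scalerA mulrC -scalerA.
rewrite -!comp_homA; congr (- (_ *: (_ *: basis R (comp_hom h _)))).
apply: hom_Delta_ext => j; apply: val_inj => /=.
have bik : bump i k = k.+1 by rewrite /bump ik.
have uki : unbump k i = i by rewrite /unbump ltnNge ik subn0.
by rewrite e1 [RHS]bumpC bik uki.
Qed.

Section InducedMap.
Variables (n : nat) (G G' : quiver) (phi : quiver_hom G G').

Definition chain_map : chain n G -> chain n G' :=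
  lin_ext (fun f : quiver_hom (Delta n) G => basis R (comp_hom phi f)).

HB.instance Definition _ := GRing.Linear.on chain_map.

Lemma chain_mapE (f : quiver_hom (Delta n) G) :
  chain_map (basis R f) = basis R (comp_hom phi f).
Proof. exact: lin_ext_basis. Qed.
End InducedMap.

Lemma boundary_chain_map n G G' (phi : quiver_hom G G') (c : chain n.+1 G) :
  boundary (chain_map phi c) = chain_map phi (boundary c).
Proof.
pose f := @boundary n G' \o @chain_map n.+1 G G' phi.
pose g := @chain_map n G G' phi \o @boundary n G.
have fg : f =1 g; last exact: (fg c).
apply: free_module_ind => h; rewrite /f /g /= chain_mapE !boundaryE linear_sum.
by apply: eq_bigr => i _; rewrite linearZ /= chain_mapE comp_homA.
Qed.

Section HomologyMap.
Variables (n : nat) (G G' : quiver) (phi : quiver_hom G G').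

Fact chain_map_cycle (z : cycles n G) : chain_map phi z \in @is_cycle n G'.
Proof.
case: z => c; rewrite /is_cycle; case: n c => //= m c /eqP c0; apply/eqP.
by rewrite boundary_chain_map c0 linear0.
Qed.

Definition cycle_map (z : cycles n G) : cycles n G' := Cycle (chain_map_cycle z).

Definition homology_map (x : homology n G) : homology n G' :=
  homology_class (cycle_map (repr x)).

Lemma homology_mapE (z : cycles n G) :
  homology_map (homology_class z) = homology_class (cycle_map z).
Proof.
have /eqP/homology_classP[c zc] := homology_class_surj (homology_class z).
apply/eqP/homology_classP; exists (chain_map phi c).
by rewrite boundary_chain_map -zc linearB.
Qed.

Fact homology_map_is_linear : linear homology_map.
Proof.
move=> a x y; rewrite -(homology_class_surj x) -(homology_class_surj y).
rewrite -linearP !homology_mapE -linearP; congr homology_class.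
by apply: val_inj; rewrite /= !linearP.
Qed.

HB.instance Definition _ :=
  GRing.isLinear.Build R (homology n G) (homology n G') _ homology_map
    homology_map_is_linear.
End HomologyMap.
End Homology.

Arguments homology_map R n {G G'} phi _.

Record subquiver (G : quiver) := Subquiver {
  subV : set (vert G);
  subE : set (edge G);
  subV_neq0 : subV !=set0;
  sub_src : forall e, subE e -> subV (src e);
  sub_tgt : forall e, subE e -> subV (tgt e) }.

Definition is_full (G : quiver) (H : subquiver G) :=
  subE H = [set e | subV H (src e) /\ subV H (tgt e)].

Record full_subquiver (G : quiver) := FullSubquiver {
  full_sub :> subquiver G;
  full_subP : is_full full_sub }.

Section StrongCylinder.
Variables (G : quiver) (H : full_subquiver G).

Definition crossing (e : edge G) : bool :=
  (src e \in subV H) (+) (tgt e \in subV H).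

Inductive cyl_vert :=
| CylV0 of vert G
| CylV1 of subV H.

Inductive cyl_edge :=
| CylE0 of edge G
| CylE1 of subE H
| CylV01 of subV H
| CylE01 of subE H
| CylCross of {e : edge G | crossing e}.

(* The source or target of [e_e]: level 1 when the vertex lies in the         *)
(* subquiver, level 0 otherwise.                                              *)
Definition cyl_lift (v : vert G) : cyl_vert :=
  if insub v is Some w then CylV1 w else CylV0 v.

Definition src1 (e : subE H) : subV H :=
  exist _ (src (val e)) (mem_set (sub_src (set_mem (valP e)))).

Definition tgt1 (e : subE H) : subV H :=
  exist _ (tgt (val e)) (mem_set (sub_tgt (set_mem (valP e)))).

Definition cyl_src (a : cyl_edge) : cyl_vert :=
  match a with
  | CylE0 e => CylV0 (src e)
  | CylE1 e => CylV1 (src1 e)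
  | CylV01 v => CylV0 (val v)
  | CylE01 e => CylV0 (src (val e))
  | CylCross e => cyl_lift (src (val e))
  end.

Definition cyl_tgt (a : cyl_edge) : cyl_vert :=
  match a with
  | CylE0 e => CylV0 (tgt e)
  | CylE1 e => CylV1 (tgt1 e)
  | CylV01 v => CylV1 v
  | CylE01 e => CylV1 (tgt1 e)
  | CylCross e => cyl_lift (tgt (val e))
  end.

Fact cyl_inhabited : inhabited cyl_vert.
Proof. by have [v] := vert_inhabited G; split; exact: CylV0 v. Qed.

Definition cylinder : quiver := Quiver cyl_src cyl_tgt cyl_inhabited.

Definition cyl_i0 : quiver_hom G cylinder :=
  @mk_hom G cylinder CylV0 CylE0 (fun e => conj erefl erefl).

(* In the last case neither endpoint of [e] lies in [H], because [H] is full. *)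
Definition cyl_i1E (e : edge G) : cyl_edge :=
  if insub e is Some e1 then CylE1 e1
  else if insub e is Some e2 then CylCross e2
  else CylE0 e.

Lemma cyl_lift_in (v : vert G) (vH : v \in subV H) :
  cyl_lift v = CylV1 (exist _ v vH).
Proof. by rewrite /cyl_lift (insubT (fun x => x \in subV H) vH). Qed.

Lemma cyl_lift_notin (v : vert G) : v \notin subV H -> cyl_lift v = CylV0 v.
Proof. by move=> vH; rewrite /cyl_lift insubN. Qed.

Fact cyl_i1P (e : edge G) :
  cyl_src (cyl_i1E e) = cyl_lift (src e) /\
  cyl_tgt (cyl_i1E e) = cyl_lift (tgt e).
Proof.
rewrite /cyl_i1E; case: insubP => [[e1 e1P] /= _ <-|].
  have sH := mem_set (sub_src (set_mem e1P)).
  have tH := mem_set (sub_tgt (set_mem e1P)).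
  rewrite (cyl_lift_in sH) (cyl_lift_in tH).
  by split; congr CylV1; exact: val_inj.
move=> eH; case: insubP => [e2 _ /= <- //|ne /=].
suff [] : src e \notin subV H /\ tgt e \notin subV H.
  by move=> /cyl_lift_notin -> /cyl_lift_notin ->.
move: ne eH; rewrite /crossing full_subP.
have [sH|sH] := boolP (src e \in subV H);
  have [tH|tH] := boolP (tgt e \in subV H) => //= _.
by rewrite mem_set //; split; exact: set_mem.
Qed.

Definition cyl_i1 : quiver_hom G cylinder :=
  @mk_hom G cylinder cyl_lift cyl_i1E cyl_i1P.
End StrongCylinder.

Definition lsh_step (G1 G2 : quiver) (f0 f1 : quiver_map G1 G2) :=
  exists (H : full_subquiver G1) (F : quiver_hom (cylinder H) G2),
    comp_map F (cyl_i0 H) = f0 /\ comp_map F (cyl_i1 H) = f1.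

Definition lsh_homotopic (G1 G2 : quiver) :
    quiver_map G1 G2 -> quiver_map G1 G2 -> Prop :=
  clos_refl_sym_trans (quiver_map G1 G2) (@lsh_step G1 G2).

(* Main.v *)
(* A prism argument. For a simplex [f] with vertices v_0, ..., v_n, let h_i f *)
(* be the (n+1)-simplex of the cylinder with vertices                         *)
(* (v_0,0), ..., (v_i,0), i_1 v_i, ..., i_1 v_n.                              *)
(* It exists only when v_i lies in the subquiver, as otherwise i_1 v_i is     *)
(* (v_i,0); set P f = sum of (-1)^i h_i f over those i. In the boundary of    *)
(* P f, the faces through the middle of the prism are c_i - c_(i+1), where    *)
(* c_k f is i_0 f before the k-th vertex and i_1 f from it on. For v_i        *)
(* outside the subquiver c_i = c_(i+1), so the sum over the remaining i still *)
(* telescopes to i_1 f - i_0 f, and P is a chain homotopy from i_0 to i_1.    *)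
(* All maps in a chain of elementary homotopies starting at a homomorphism    *)
(* are homomorphisms, so the equalities in homology compose.                  *)
Require Import Defs.
From HB Require Import structures.
From mathcomp Require Import all_boot all_algebra.
From mathcomp Require Import boolp classical_sets zify.

Set Implicit Arguments.
Unset Strict Implicit.
Unset Printing Implicit Defensive.

Import GRing.Theory.
Local Open Scope ring_scope.

(** An elementary homotopy is a map [F] out of a strong cylinder, so it suffices that i_0 and i_1
    differ by a boundary on every cycle, which is [prism_homotopy_cycle]; [F] then transports the
    bounding chain. The geometry is in [prism_face] (outer faces) and [prism_face_cut] (middle
    faces), [prism_sum] does the cancellation, and [cut_map_notin] explains why the prisms missing
    outside the subquiver leave no gap. [lsh_homotopic_homology] passes to the generated
    equivalence. *)

Lemma comp_mapA (G G' G'' G''' : quiver) (h : quiver_map G'' G''')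
    (g : quiver_map G' G'') (f : quiver_map G G') :
  comp_map h (comp_map g f) = comp_map (comp_map h g) f.
Proof.
apply: quiver_map_ext => // e /=.
by rewrite /comp_mapE /= /comp_mapE; case: (mapE f e).
Qed.

Lemma hom_edge_ends (G G' : quiver) (f : quiver_hom G G') (e : edge G) :
  exists e', [/\ mapE f e = inl e', src e' = mapV f (src e)
               & tgt e' = mapV f (tgt e)].
Proof.
have [e' fe] := hom_mapP f e; exists e'.
by have := Defs.mapP f e; rewrite fe => -[-> ->].
Qed.

(** * Quivers whose edges are determined by their ends *)

Definition thin (G : quiver) :=
  forall e e' : edge G, src e = src e' -> tgt e = tgt e' -> e = e'.

Lemma hom_thin_ext (G G' : quiver) (f g : quiver_hom G G') :
  thin G' -> mapV f =1 mapV g -> f = g.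
Proof.
move=> thinG' fg; apply/quiver_hom_ext/quiver_map_ext => // e.
have [a [-> sa ta]] := hom_edge_ends f e.
have [b [-> sb tb]] := hom_edge_ends g e.
by congr inl; apply: thinG'; rewrite ?sa ?sb ?ta ?tb fg.
Qed.

Lemma hom_of_vertices (G G' : quiver) (v : vert G -> vert G') :
  (forall e, exists e', src e' = v (src e) /\ tgt e' = v (tgt e)) ->
  exists f : quiver_hom G G', mapV f = v.
Proof. by case/choice=> fE fP; exists (mk_hom fP). Qed.

(* The cylinder of [G] over all of [G]. Every prism is first formed in        *)
(* [box (Delta n)], which is thin, so that the simplicial identities can be   *)
(* checked on vertices, and then mapped by [box_map] and [collapse].          *)
Section Box.
Variable G : quiver.

Inductive box_edge :=
| Box0 of edge G
| Box1 of edge G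
| Box01 of edge G
| BoxV of vert G.

Definition box_src (x : box_edge) : vert G * bool :=
  match x with
  | Box0 e => (src e, false)
  | Box1 e => (src e, true)
  | Box01 e => (src e, false)
  | BoxV v => (v, false)
  end.

Definition box_tgt (x : box_edge) : vert G * bool :=
  match x with
  | Box0 e => (tgt e, false)
  | Box1 e => (tgt e, true)
  | Box01 e => (tgt e, true)
  | BoxV v => (v, true)
  end.

Fact box_inhabited : inhabited (vert G * bool).
Proof. by have [v] := vert_inhabited G; split; exact: (v, false). Qed.

Definition box : quiver := Quiver box_src box_tgt box_inhabited.
End Box.

(** * Functoriality of the box *)

Section BoxMap.
Variables (G G' : quiver) (f : quiver_map G G').

Definition box_mapV (p : vert (box G)) : vert (box G') := (mapV f p.1, p.2).

Definition box_mapE (x : edge (box G)) : edge (box G') + vert (box G') :=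
  match x with
  | Box0 e => match mapE f e with
              | inl e' => inl (Box0 e')
              | inr v => inr (v, false)
              end
  | Box1 e => match mapE f e with
              | inl e' => inl (Box1 e')
              | inr v => inr (v, true)
              end
  | Box01 e => match mapE f e with
               | inl e' => inl (Box01 e')
               | inr v => inl (BoxV v)
               end
  | BoxV v => inl (BoxV (mapV f v))
  end.

Fact box_mapP x :
  match box_mapE x with
  | inl e' => src e' = box_mapV (src x) /\ tgt e' = box_mapV (tgt x)
  | inr v => v = box_mapV (src x) /\ v = box_mapV (tgt x)
  end.
Proof.
rewrite /box_mapV; case: x => [e|e|e|//] /=;
  by have := Defs.mapP f e; case: (mapE f e) => [e'|v] [/= <- <-].
Qed.

Definition box_map : quiver_map (box G) (box G') := QuiverMap box_mapP.
End BoxMap.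

Lemma box_map_comp (G G' G'' : quiver) (g : quiver_map G' G'')
    (f : quiver_map G G') :
  box_map (comp_map g f) = comp_map (box_map g) (box_map f).
Proof.
apply: quiver_map_ext => // -[e|e|e|//] /=;
  by rewrite /comp_mapE /= /comp_mapE; case: (mapE f e).
Qed.

Lemma box_map_hom (G G' : quiver) (f : quiver_hom G G') : is_hom (box_map f).
Proof.
case=> [e|e|e|v] /=; last by eexists.
all: by have [e' ->] := hom_mapP f e; eexists.
Qed.

Definition box_hom (G G' : quiver) (f : quiver_hom G G') :
  quiver_hom (box G) (box G') := QuiverHom (box_map_hom f).

Lemma box_Delta_thin n : thin (box (Delta n)).
Proof.
have edge_eq (e e' : Delta_edge n) :
    (val e).1 = (val e').1 -> (val e).2 = (val e').2 -> e = e'.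
  by move=> es et; apply: val_inj; move: es et;
    case: (val e) (val e') => [a b] [c d] /= -> ->.
case=> [e|e|e|v] [e'|e'|e'|w] //= [es] [et]; try by congr (_ _); exact: edge_eq.
(* A [Box01] and a [BoxV] edge with the same ends would give a loop in [Delta n]. *)
- by have := valP e; rewrite /= es et ltnn.
- by have := valP e'; rewrite /= -es -et ltnn.
- by rewrite es.
Qed.

(** * From the box to the strong cylinder *)

Section Collapse.
Variables (G : quiver) (H : full_subquiver G).

(** The edge from (s(e),0) to i_1(t(e)). In the second case fullness puts s(e) outside [H], so
    [cyl_i1E] is a crossing edge that starts at level 0. *)
Definition cyl_i01E (e : edge G) : cyl_edge H :=
  if insub e is Some e1 then CylE01 e1
  else if tgt e \in subV H then cyl_i1E H e else CylE0 H e.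

Lemma notin_subE_src (e : edge G) : src e \notin subV H -> e \notin subE H.
Proof.
by apply: contra => /set_mem eH; apply/mem_set/(@sub_src _ H).
Qed.

Lemma notin_subE_tgt (e : edge G) : tgt e \notin subV H -> e \notin subE H.
Proof.
by apply: contra => /set_mem eH; apply/mem_set/(@sub_tgt _ H).
Qed.

Lemma cyl_i01E_tgt (e : edge G) :
  tgt e \notin subV H -> cyl_i01E e = CylE0 H e.
Proof.
by move=> tH; rewrite /cyl_i01E insubN ?(negbTE tH) ?notin_subE_tgt.
Qed.

Lemma cyl_i01E_src (e : edge G) :
  src e \notin subV H -> cyl_i01E e = cyl_i1E H e.
Proof.
move=> sH; have eH := notin_subE_src sH.
rewrite /cyl_i01E insubN //; case: ifPn => // tH.
by rewrite /cyl_i1E !insubN // /crossing (negbTE sH) (negbTE tH).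
Qed.

Lemma cyl_i01P (e : edge G) :
  cyl_src (cyl_i01E e) = CylV0 H (src e) /\
  cyl_tgt (cyl_i01E e) = cyl_lift H (tgt e).
Proof.
have [tH|tH] := boolP (tgt e \in subV H); last first.
  by rewrite cyl_i01E_tgt // cyl_lift_notin.
have [sH|sH] := boolP (src e \in subV H); last first.
  by rewrite cyl_i01E_src //; have [-> ->] := cyl_i1P H e; rewrite cyl_lift_notin.
have eH : e \in subE H by rewrite full_subP mem_set //; split; exact: set_mem.
rewrite /cyl_i01E (insubT (fun x => x \in subE H) eH) /=; split=> //.
by rewrite (cyl_lift_in tH); congr CylV1; apply: val_inj.
Qed.

Definition collapseV (p : vert (box G)) : vert (cylinder H) :=
  if p.2 then cyl_lift H p.1 else CylV0 H p.1.

(** Over a vertex outside [H] both levels coincide, so the vertical edge shrinks to a vertex; hence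
    [collapse] is only a quiver map. *)
Definition collapseE (x : edge (box G)) :
    edge (cylinder H) + vert (cylinder H) :=
  match x with
  | Box0 e => inl (CylE0 H e)
  | Box1 e => inl (cyl_i1E H e)
  | Box01 e => inl (cyl_i01E e)
  | BoxV v => if insub v is Some w then inl (CylV01 w) else inr (CylV0 H v)
  end.

Fact collapseP x :
  match collapseE x with
  | inl e' => src e' = collapseV (src x) /\ tgt e' = collapseV (tgt x)
  | inr v => v = collapseV (src x) /\ v = collapseV (tgt x)
  end.
Proof.
case: x => [e|e|e|v] //=; [exact: cyl_i1P|exact: cyl_i01P|].
rewrite /collapseV /=; case: insubP => [[w wH] /= _ <-|vH].
  by rewrite cyl_lift_in.
by rewrite cyl_lift_notin.
Qed.

Definition collapse : quiver_map (box G) (cylinder H) := QuiverMap collapseP.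
End Collapse.

(** * Prism simplices over [Delta n] and their faces *)

Section Prism.
Variable n : nat.

Definition cutV (k : nat) (a : vert (Delta n)) : vert (box (Delta n)) :=
  (a, (k <= a)%N).

Definition cutE (k : nat) (e : edge (Delta n)) : edge (box (Delta n)) :=
  if (tgt e < k)%N then @Box0 (Delta n) e
  else if (src e < k)%N then @Box01 (Delta n) e else @Box1 (Delta n) e.

Fact cutP k e :
  src (cutE k e) = cutV k (src e) /\ tgt (cutE k e) = cutV k (tgt e).
Proof.
case: e => [[a b] /= ab]; rewrite /cutE /cutV /=.
by case: (ltnP b k) => bk /=; case: (ltnP a k) => ak //=; lia.
Qed.

Definition cut k : quiver_hom (Delta n) (box (Delta n)) := mk_hom (cutP k).

(** [unbump i] is the i-th degeneracy: the vertex i occurs twice, at level 0 and then at level 1. *)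
Definition prismV (i : 'I_n.+1) (a : vert (Delta n.+1)) :
    vert (box (Delta n)) :=
  (inord (unbump i a), (i < a)%N).

Lemma prism_ord (i : 'I_n.+1) (a : 'I_n.+2) :
  (inord (unbump i a) : 'I_n.+1) = unbump i a :> nat.
Proof.
by rewrite inordK // /unbump; case: ltnP; have := ltn_ord i;
  have := ltn_ord a; lia.
Qed.

Lemma prism_exists i :
  exists f : quiver_hom (Delta n.+1) (box (Delta n)), mapV f = prismV i.
Proof.
apply: hom_of_vertices => -[[a b] /= ab]; rewrite /prismV.
have [ea eb] := (prism_ord i a, prism_ord i b).
have [elt|] := ltnP (inord (unbump i a) : 'I_n.+1) (inord (unbump i b) : 'I_n.+1).
  pose e : Delta_edge n := exist _ (_, _) elt.
  have [bi|ib] := leqP b i.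
    have -> : (i < a)%N = false by lia.
    by exists (@Box0 (Delta n) e).
  have [ai|ia] := leqP a i.
    by exists (@Box01 (Delta n) e).
  by exists (@Box1 (Delta n) e).
(* The degeneracy identifies a < b only for a = i, b = i + 1: this is the vertical edge. *)
rewrite ea eb => ba.
have -> : inord (unbump i b) = inord (unbump i a) :> 'I_n.+1.
  by apply: val_inj; rewrite /= ea eb; move: ba; rewrite /unbump; lia.
exists (@BoxV (Delta n) (inord (unbump i a))).
suff [-> ->] : (i < a)%N = false /\ (i < b)%N by [].
by move: ba; rewrite /unbump; lia.
Qed.

Definition prism i : quiver_hom (Delta n.+1) (box (Delta n)) :=
  projT1 (cid (prism_exists i)).

Lemma prismVE i : mapV (prism i) = prismV i.
Proof. by rewrite /prism; case: cid. Qed.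

Lemma prism_vertical i e v :
  mapE (prism i) e = inl (@BoxV (Delta n) v) -> v = i.
Proof.
move=> pe; have := Defs.mapP (prism i) e; rewrite pe prismVE.
case: e {pe} => [[a b] /= ab] /=; rewrite /prismV.
move=> [[va ia] [vb ib]]; apply: val_inj; move: ia ib.
have := congr1 val va; have := congr1 val vb.
by rewrite /= !prism_ord /unbump; lia.
Qed.

(** Dropping (i,0) leaves the cut at i, dropping (i,1) the cut at i + 1. *)
Lemma prism_face_cut (i : 'I_n.+1) (j : 'I_n.+2) (k : nat) :
  (j == i :> nat) || (j == i.+1 :> nat) -> k = j ->
  comp_hom (prism i) (face j) = cut k.
Proof.
move=> ji ->; apply: hom_thin_ext; first exact: box_Delta_thin.
move=> a /=; rewrite prismVE /prismV /cutV /=; congr (_, _).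
  by apply: val_inj; rewrite /= (prism_ord i (lift j a)) /= /unbump /bump; lia.
by rewrite /bump; lia.
Qed.
End Prism.

(** Both outer identities at once: for i' < j' it reads i = i', j = j' + 1, and otherwise i = i' +
    1, j = j'. *)
Lemma prism_face n (i : 'I_n.+2) (j : 'I_n.+3) (i' : 'I_n.+1) (j' : 'I_n.+2) :
  i = bump j' i' :> nat -> j = (j' + (i' < j'))%N :> nat ->
  comp_hom (prism i) (face j) = comp_hom (box_hom (face j')) (prism i').
Proof.
move=> ei ej; apply: hom_thin_ext; first exact: box_Delta_thin.
move=> a /=; rewrite !prismVE /prismV /box_mapV /=; congr (_, _).
  apply: val_inj; rewrite /= (prism_ord i (lift j a)) (prism_ord i' a) /=.
  by rewrite ei ej /unbump /bump; lia.
by rewrite ei ej /bump; lia.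
Qed.

(* [F i j] is the [j]-th face of the [i]-th prism simplex, [W i j] the [i]-th *)
(* prism simplex of the [j]-th face, both with signs.                         *)
Lemma prism_sum (M : zmodType) n (F W : nat -> nat -> M) (g : nat -> M) :
  (forall i j, (j <= i < n)%N -> F i.+1 j = - W i j) ->
  (forall i j, (i < j < n.+1)%N -> F i j.+1 = - W i j) ->
  (forall i, (i <= n)%N -> F i i + F i i.+1 = g i - g i.+1) ->
  \sum_(0 <= i < n.+1) \sum_(0 <= j < n.+2) F i j =
  g 0%N - g n.+1 - \sum_(0 <= i < n) \sum_(0 <= j < n.+1) W i j.
Proof.
move=> Flow Fhigh Fmid.
(* Each row splits into j < i, the pair j = i, i + 1, and j > i + 1, the last shifted down by
   one. *)
have -> : \sum_(0 <= i < n.+1) \sum_(0 <= j < n.+2) F i j =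
    \sum_(0 <= i < n.+1) \sum_(0 <= j < i) F i j +
    (\sum_(0 <= i < n.+1) (g i - g i.+1) +
    \sum_(0 <= i < n.+1) \sum_(i.+1 <= j < n.+1) F i j.+1).
  rewrite -!big_split /=; apply: eq_big_nat => i /andP[_ lt_in].
  rewrite (@big_cat_nat _ _ _ i) //=; last lia.
  rewrite [X in _ + X]big_ltn; last lia.
  rewrite [X in _ + (_ + X)]big_ltn; last lia.
  by rewrite [X in _ + X]addrA Fmid // big_add1.
rewrite (telescope_sumr_eq (fun i => - g i)) //; last first.
  by move=> i _; rewrite opprK addrC.
(* The first row has no j < i and the last no j > i + 1; without them the two outer sums range over
   i < n and match [W] split after j = i. *)
rewrite big_nat_recl // [X in X + _ + _]big_geq // add0r opprK.
rewrite [- _ + _]addrC addrCA.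
congr (_ + _).
rewrite [X in _ + X]big_nat_recr //= [X in _ + (_ + X)]big_geq // addr0.
rewrite -big_split -sumrN /=; apply: eq_big_nat => i /andP[_ lt_in].
rewrite (@big_cat_nat _ _ _ i.+1 0 n.+1) //=; last lia.
rewrite opprD -!sumrN; congr (_ + _); apply: eq_big_nat => j ij.
  by rewrite Flow //; lia.
by rewrite Fhigh //; lia.
Qed.

(** * The prism operator as a chain homotopy *)

Section PrismOperator.
Variables (R : comPzRingType) (G : quiver) (H : full_subquiver G).

(** The value 0 on other quiver maps allows rewriting with equalities of maps without carrying
    proofs of [is_hom]. *)
Definition simplex (m : nat) (G' : quiver) (f : quiver_map (Delta m) G') :
    chain R m G' :=
  if pselect (is_hom f) is left fP then basis R (QuiverHom fP) else 0.

Lemma simplex_hom m G' (f : quiver_hom (Delta m) G') : simplex f = basis R f.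
Proof.
rewrite /simplex; case: pselect => [fP|/(_ (hom_mapP f))//].
by congr basis; apply: quiver_hom_ext.
Qed.

Definition prism_map n (f : quiver_hom (Delta n) G) (i : 'I_n.+1) :
    quiver_map (Delta n.+1) (cylinder H) :=
  comp_map (comp_map (collapse H) (box_map f)) (prism i).

Definition cut_map n (f : quiver_hom (Delta n) G) (k : nat) :
    quiver_map (Delta n) (cylinder H) :=
  comp_map (comp_map (collapse H) (box_map f)) (cut n k).

Lemma prism_map_hom n (f : quiver_hom (Delta n) G) i :
  mapV f i \in subV H -> is_hom (prism_map f i).
Proof.
move=> iH e; rewrite /prism_map /= /comp_mapE /= /comp_mapE.
have [x px] := hom_mapP (prism i) e; rewrite px.
case: x px => [d|d|d|v] px /=; try by have [d' ->] := hom_mapP f d; eexists.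
rewrite (prism_vertical px) (insubT (fun x => x \in subV H) iH); by eexists.
Qed.

Lemma cut_map0 n (f : quiver_hom (Delta n) G) :
  cut_map f 0 = comp_hom (cyl_i1 H) f.
Proof.
apply: quiver_map_ext => // e; rewrite /= /comp_mapE /= /comp_mapE /cutE /=.
by have [e' ->] := hom_mapP f e.
Qed.

Lemma cut_map_max n (f : quiver_hom (Delta n) G) :
  cut_map f n.+1 = comp_hom (cyl_i0 H) f.
Proof.
apply: quiver_map_ext => [a|e].
  by rewrite /= /collapseV /= leqNgt ltn_ord.
rewrite /= /comp_mapE /= /comp_mapE /cutE ltn_ord /=.
by have [e' ->] := hom_mapP f e.
Qed.

(** Moving the cut from i to i + 1 turns edges entering i from [Box01] into [Box0] and edges leaving
    i from [Box1] into [Box01]; [collapse] does not see this when the vertex is outside [H]. *)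
Lemma cut_map_notin n (f : quiver_hom (Delta n) G) (i : 'I_n.+1) :
  mapV f i \notin subV H -> cut_map f i = cut_map f i.+1.
Proof.
move=> iH; apply: quiver_map_ext => [a|e].
  rewrite /= /collapseV /=; have [->|ai] := eqVneq a i.
    by rewrite leqnn ltnn cyl_lift_notin.
  by rewrite [(i <= a)%N]leq_eqVlt eq_sym (negbTE (ai : a != i :> nat)).
rewrite /= /comp_mapE /= /comp_mapE /cutE.
have [e' [fe se te]] := hom_edge_ends f e.
case: e fe se te => [[a b] /= ab] fe se te.
rewrite !ltnS; have [bi|ib|/val_inj bi] := ltngtP b i.
- by rewrite /= fe.
- have [ai|ia|/val_inj ai] /= := ltngtP a i; rewrite fe //=.
  by rewrite cyl_i01E_src // se ai.
- by subst b; rewrite ab /= fe /= cyl_i01E_tgt ?te.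
Qed.

Definition prism_simplex n (f : quiver_hom (Delta n) G) (i : 'I_n.+1) :
    chain R n.+1 (cylinder H) :=
  if mapV f i \in subV H then simplex (prism_map f i) else 0.

Definition prism_op n : chain R n G -> chain R n.+1 (cylinder H) :=
  lin_ext (fun f : quiver_hom (Delta n) G =>
    \sum_(i < n.+1) (-1) ^+ i *: prism_simplex f i).

HB.instance Definition _ n := GRing.Linear.on (@prism_op n).

(** The test precedes [simplex] because the two middle faces are homomorphisms even when the prism
    simplex is not. *)
Definition prism_simplex_face n (f : quiver_hom (Delta n) G) (i : 'I_n.+1)
    (j : 'I_n.+2) : chain R n (cylinder H) :=
  if mapV f i \in subV H then simplex (comp_map (prism_map f i) (face j)) else 0.

Lemma boundary_prism_simplex n (f : quiver_hom (Delta n) G) i :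
  boundary (prism_simplex f i) =
  \sum_(j < n.+2) (-1) ^+ j *: prism_simplex_face f i j.
Proof.
rewrite /prism_simplex /prism_simplex_face; case: ifP => iH; last first.
  by rewrite linear0 big1 // => j _; rewrite scaler0.
rewrite (simplex_hom (QuiverHom (prism_map_hom iH))) boundaryE.
by apply: eq_bigr => j _; rewrite -simplex_hom.
Qed.

Lemma prism_simplex_faceE n (f : quiver_hom (Delta n.+1) G) (i : 'I_n.+2)
    (j : 'I_n.+3) (i' : 'I_n.+1) (j' : 'I_n.+2) :
  i = bump j' i' :> nat -> j = (j' + (i' < j'))%N :> nat ->
  prism_simplex_face f i j = prism_simplex (comp_hom f (face j')) i'.
Proof.
move=> ei ej; rewrite /prism_simplex_face /prism_simplex.
have -> : mapV f i = mapV (comp_hom f (face j')) i'.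
  by congr (mapV f _); apply: val_inj.
case: ifP => // _; congr simplex; rewrite /prism_map box_map_comp -!comp_mapA.
congr (comp_map _ (comp_map _ _)).
exact: (congr1 (@hom_map _ _) (prism_face ei ej)).
Qed.

Lemma prism_simplex_face_cut n (f : quiver_hom (Delta n) G) (i : 'I_n.+1)
    (j0 j1 : 'I_n.+2) :
  j0 = i :> nat -> j1 = i.+1 :> nat ->
  prism_simplex_face f i j0 - prism_simplex_face f i j1 =
  simplex (cut_map f i) - simplex (cut_map f i.+1).
Proof.
move=> e0 e1; rewrite /prism_simplex_face; case: ifPn => iH; last first.
  by rewrite (cut_map_notin iH) !subrr.
rewrite /prism_map -!comp_mapA /cut_map -!comp_mapA.
have c0 : comp_hom (prism i) (face j0) = cut n i.
  by apply: prism_face_cut; rewrite ?e0 ?eqxx.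
have c1 : comp_hom (prism i) (face j1) = cut n i.+1.
  by apply: prism_face_cut; rewrite ?e1 ?eqxx ?orbT.
by rewrite -[comp_map _ (face j0)]/(hom_map (comp_hom _ _)) c0
  -[comp_map _ (face j1)]/(hom_map (comp_hom _ _)) c1.
Qed.

(** Indexed by [nat] through [inord], so that [prism_sum] can shift indices. *)
Definition signed_face n (f : quiver_hom (Delta n) G) (i j : nat) :=
  (-1) ^+ i *: ((-1) ^+ j *: prism_simplex_face f (inord i) (inord j)).

Lemma boundary_prism_basis n (f : quiver_hom (Delta n) G) :
  boundary (prism_op (basis R f)) =
  \sum_(0 <= i < n.+1) \sum_(0 <= j < n.+2) signed_face f i j.
Proof.
rewrite /prism_op lin_ext_basis linear_sum big_mkord; apply: eq_bigr => i _.
rewrite linearZ /= boundary_prism_simplex scaler_sumr big_mkord.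
by apply: eq_bigr => j _; rewrite /signed_face !inord_val.
Qed.

Lemma signed_face_cut n (f : quiver_hom (Delta n) G) i : (i <= n)%N ->
  signed_face f i i + signed_face f i i.+1 =
  simplex (cut_map f i) - simplex (cut_map f i.+1).
Proof.
move=> le_in; rewrite /signed_face !scalerA -!exprD addnS exprS addnn.
rewrite -signr_odd odd_double expr0 mulr1 scale1r scaleN1r.
have ii : (inord i : 'I_n.+1) = i :> nat by rewrite inordK.
by rewrite (@prism_simplex_face_cut _ _ (inord i)) ii // inordK //; lia.
Qed.

Lemma boundary_prism0 (f : quiver_hom (Delta 0) G) :
  boundary (prism_op (basis R f)) =
  basis R (comp_hom (cyl_i1 H) f) - basis R (comp_hom (cyl_i0 H) f).
Proof.
rewrite boundary_prism_basis.
(* The sum over [W] is empty here, so the zero function serves. *)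
rewrite (@prism_sum _ 0 _ (fun _ _ => 0) (fun k => simplex (cut_map f k))).
- by rewrite cut_map0 cut_map_max !simplex_hom big_geq // subr0.
- by move=> i j; lia.
- by move=> i j; lia.
- exact: signed_face_cut.
Qed.

Lemma boundary_prismS n (f : quiver_hom (Delta n.+1) G) :
  boundary (prism_op (basis R f)) + prism_op (boundary (basis R f)) =
  basis R (comp_hom (cyl_i1 H) f) - basis R (comp_hom (cyl_i0 H) f).
Proof.
pose W i j := (-1) ^+ i *: ((-1) ^+ j *:
  prism_simplex (comp_hom f (face (inord j))) (inord i : 'I_n.+1)).
have -> : prism_op (boundary (basis R f)) =
    \sum_(0 <= i < n.+1) \sum_(0 <= j < n.+2) W i j.
  rewrite boundaryE linear_sum exchange_big /= big_mkord.
  apply: eq_bigr => j _; rewrite linearZ /= /prism_op lin_ext_basis.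
  rewrite scaler_sumr big_mkord; apply: eq_bigr => i _.
  by rewrite /W !inord_val !scalerA mulrC.
rewrite boundary_prism_basis.
rewrite (@prism_sum _ n.+1 _ W (fun k => simplex (cut_map f k))).
- by rewrite cut_map0 cut_map_max !simplex_hom subrK.
- move=> i j ij; rewrite /W /signed_face exprS -scalerA scaleN1r.
  congr (- (_ *: (_ *: _))); apply: prism_simplex_faceE;
    by rewrite !inordK /bump; lia.
- move=> i j ij; rewrite /W /signed_face exprS -[in LHS]scalerA scaleN1r scalerN.
  congr (- (_ *: (_ *: _))); apply: prism_simplex_faceE;
    by rewrite !inordK /bump; lia.
- exact: signed_face_cut.
Qed.

(** On a cycle the term [prism_op (boundary z)] vanishes; degree 0 has no such term and is treated
    apart. *)
Lemma prism_homotopy_cycle n (z : cycles R n G) :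
  chain_map (cyl_i1 H) z - chain_map (cyl_i0 H) z = boundary (prism_op z).
Proof.
case: z => c; rewrite /is_cycle; case: n c => [|n] c cz /=.
  pose g := chain_map (R := R) (n := 0) (cyl_i1 H) \- chain_map (cyl_i0 H).
  pose g' := @boundary R _ _ \o @prism_op 0.
  suff : g =1 g' by move/(_ c).
  apply: free_module_ind => f.
  by rewrite /g /g' /= !chain_mapE boundary_prism0.
pose g := chain_map (R := R) (n := n.+1) (cyl_i1 H) \- chain_map (cyl_i0 H).
pose g' := (@boundary R _ _ \o @prism_op n.+1) \+ (@prism_op n \o @boundary R _ _).
suff /(_ c) : g =1 g'.
  by rewrite /g /g' /=; move/eqP: cz => ->; rewrite linear0 addr0.
apply: free_module_ind => f.
by rewrite /g /g' /= !chain_mapE boundary_prismS.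
Qed.
End PrismOperator.

(** * Passage to homology *)

Lemma chain_map_comp (R : comPzRingType) n (G G' G'' : quiver)
    (g : quiver_hom G' G'') (f : quiver_hom G G') (c : chain R n G) :
  chain_map (comp_hom g f) c = chain_map g (chain_map f c).
Proof.
pose h := chain_map (R := R) (n := n) g \o chain_map f.
suff : chain_map (comp_hom g f) =1 h by move/(_ c).
by apply: free_module_ind => x; rewrite /h /= !chain_mapE comp_homA.
Qed.

Lemma homology_map_cylinder (R : comPzRingType) n (G G' : quiver)
    (H : full_subquiver G) (F : quiver_hom (cylinder H) G') :
  homology_map R n (comp_hom F (cyl_i0 H)) =
  homology_map R n (comp_hom F (cyl_i1 H)).
Proof.
apply/funext => x; rewrite -(homology_class_surj x) !homology_mapE.
apply/esym/eqP/homology_classP; exists (chain_map F (prism_op H (repr x))).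
by rewrite boundary_chain_map -prism_homotopy_cycle linearB /= !chain_map_comp.
Qed.

(** Intermediate maps are mere quiver maps, so the induction also carries [is_hom], as an
    equivalence to survive symmetry; both ends of a step are composites of homomorphisms. *)
Lemma lsh_homotopic_homology (R : comPzRingType) n (G G' : quiver)
    (f g : quiver_map G G') :
  lsh_homotopic f g ->
  (is_hom f <-> is_hom g) /\
  forall (fP : is_hom f) (gP : is_hom g),
    homology_map R n (QuiverHom fP) = homology_map R n (QuiverHom gP).
Proof.
elim=> {f g} [f g [H [F [<- <-]]]|f|f g _ [fg IH]|f g h _ [fg IHf] _ [gh IHg]].
- split=> [|fP gP].
    by split=> _; [exact: (comp_is_hom F (cyl_i1 H))
                  |exact: (comp_is_hom F (cyl_i0 H))].
  have -> : QuiverHom fP = comp_hom F (cyl_i0 H) by apply: quiver_hom_ext.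
  have -> : QuiverHom gP = comp_hom F (cyl_i1 H) by apply: quiver_hom_ext.
  exact: homology_map_cylinder.
- by split=> // fP gP; congr homology_map; apply: quiver_hom_ext.
- by split=> [|fP gP]; [exact: iff_sym|rewrite IH].
- split=> [|fP hP]; first exact: iff_trans gh.
  by have gP := fg.1 fP; rewrite (IHf fP gP) IHg.
Qed.

Theorem theorem4p1 (R : comPzRingType) (G1 G2 : quiver)
    (phi psi : quiver_hom G1 G2) :
  lsh_homotopic phi psi ->
  forall n : nat,
    homology_map R n phi = homology_map R n psi
      :> (homology R n G1 -> homology R n G2).
Proof.
move=> phi_psi n; case: phi psi phi_psi => [f fP] [g gP] /= fg.
exact: (lsh_homotopic_homology R n fg).2.
Qed.
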